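(* Let $X$ be a (real) Banach space and let $Y$ be a linear subspace of $X$ such that there exists a bounded linear extension map $L: \mathrm{Lip}_0(Y) \to \mathrm{Lip}_0(X)$, i.e., a bounded linear map with $L(g)|_Y = g$ for each $g \in \mathrm{Lip}_0(Y)$. Then the restriction of $L$ to $Y^*$ gives rise to a bounded linear extension map $G: Y^* \to X^*$; that is, there exists a bounded linear map $G: Y^*\to X^*$ with $G(g)|_Y = g$ for each $g \in Y^*$. Equivalently (the existence of such a $G$ being equivalent to local complementation), $Y$ is locally complemented in $X$. In particular, every linear subspace $Y$ of a Banach space $X$ that is a Lipschitz retract of $X$ is locally complemented in $X$.
   Context: Banach spaces are taken over $\mathbb{R}$, and $X^*$ denotes the dual of $X$. For a metric space $(M,d)$ with a distinguished point $\theta \in M$, $\mathrm{Lip}_0(M)$ is the Banach space of all Lipschitz functions $f: M \to \mathbb{R}$ with $f(\theta)=0$, with pointwise operations and norm $\|f\|_{Lip} = \sup_{x\neq y} \frac{|f(x)-f(y)|}{d(x,y)}$. For a Banach space or a linear subspace of one, the metric is the one induced by the norm and the distinguished point is the origin $0$. In particular $Y^* \subset \mathrm{Lip}_0(Y)$ and $X^*\subset \mathrm{Lip}_0(X)$. A linear subspace $Y$ of a Banach space $X$ is said to be locally complemented in $X$ if there exists $c>0$ such that for each finite dimensional subspace $M$ of $X$ there exists a continuous linear map $f: M \to Y$ with $\|f\| \le c$ and $f(x) = x$ for all $x \in M\cap Y$. A subset $B$ of a metric space $A$ is a Lipschitz retract of $A$ if there is a Lipschitz map $r: A \to B$ (i.e.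 $d(r(x),r(y)) \le k\, d(x,y)$ for all $x,y\in A$ and some constant $k$) with $r(x)=x$ for all $x \in B$. *)

(* Defs.v *)
From HB Require Import structures.
From mathcomp Require Import all_boot all_order all_algebra.
From mathcomp Require Import all_classical all_reals all_analysis.
Set Implicit Arguments.
Unset Strict Implicit.
Unset Printing Implicit Defensive.
Import Order.TTheory GRing.Theory Num.Theory.
Import numFieldNormedType.Exports.
Local Open Scope classical_set_scope.
Local Open Scope ring_scope.

Record submod (R : pzRingType) (V : lmodType R) (S : submodClosed V) := Submod {
  submod_val : V;
  submod_valP : submod_val \in (S : {pred V})
}.

Section SubmodLmodule.
Context (R : pzRingType) (V : lmodType R) (S : submodClosed V).
HB.instance Definition _ := [isSub for @submod_val R V S].
HB.instance Definition _ := [Choice of submod S by <:].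
HB.instance Definition _ := [SubChoice_isSubLmodule of submod S by <:].
End SubmodLmodule.

Section SubmodNormed.
Context (R : realType) (V : normedModType R) (S : submodClosed V).
Implicit Types x y : submod S.

Let nrm x : R := `|val x|.

Let nrmD x y : nrm (x + y) <= nrm x + nrm y.
Proof. by rewrite /nrm raddfD ler_normD. Qed.

Let nrmZ (a : R) x : nrm (a *: x) = `|a| * nrm x.
Proof. by rewrite /nrm linearZ normrZ. Qed.

Let nrm0_eq0 x : nrm x = 0 -> x = 0.
Proof. by move=> /normr0_eq0 x0; apply: val_inj; rewrite x0 raddf0. Qed.

HB.instance Definition _ :=
  Lmodule_isNormed.Build R (submod S) nrmD nrmZ nrm0_eq0.

Lemma normr_submod x : `|x| = `|val x|.
Proof. by []. Qed.
End SubmodNormed.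

Lemma sup_nonneg (R : realType) (A : set R) :
  (forall a, A a -> 0 <= a) -> 0 <= sup A.
Proof.
move=> A0; have [supA|/sup_out -> //] := pselect (has_sup A).
have [[a Aa] _] := supA; apply: le_trans (A0 a Aa) _.
exact: sup_upper_bound.
Qed.

Section LipschitzNorm.
Context (R : realType) (V : normedModType R).
Implicit Types (f g : V -> R^o) (c : R).

(* If V is trivial then the set below is empty, and its sup is 0. *)
Definition lip_norm f : R :=
  sup [set `|f p.1 - f p.2| / `|p.1 - p.2| | p in [set p : V * V | p.1 != p.2]].

Lemma lipschitzP f :
  lipschitz f <-> exists c, forall x y, `|f x - f y| <= c * `|x - y|.
Proof.
split=> [/pinfty_ex_gt0 [c c0 fc]|[c fc]].
  by exists c => x y; exact: (fc (x, y)).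
have ? : ProperFilter (globally ([set: V] `*` [set: V])).
  by apply: (@globally_properfilter _ _ (0, 0)).
by apply: (klipschitzW (k := c)) => -[x y] _; exact: fc.
Qed.

Lemma lip_norm_ge0 f : 0 <= lip_norm f.
Proof. by apply: sup_nonneg => _ [p _ <-]; exact: divr_ge0. Qed.

Lemma lip_norm_ub f x y : lipschitz f -> `|f x - f y| <= lip_norm f * `|x - y|.
Proof.
move=> /lipschitzP[c fc]; have [->|xy] := eqVneq x y.
  by rewrite !subrr !normr0 mulr0.
rewrite -ler_pdivrMr ?normr_gt0 ?subr_eq0//; apply: ub_le_sup; last first.
  by exists (x, y).
exists c => _ [[u v] /= uv <-].
by rewrite ler_pdivrMr ?normr_gt0 ?subr_eq0.
Qed.

Lemma lip_norm_le f c : 0 <= c ->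
  (forall x y, `|f x - f y| <= c * `|x - y|) -> lip_norm f <= c.
Proof.
move=> c0 fc; rewrite /lip_norm; set A := [set _ | _ in _].
have [A0|/set0P A0] := eqVneq A set0; first by rewrite A0 sup0.
apply: ge_sup => // _ [[u v] /= uv <-].
by rewrite ler_pdivrMr ?normr_gt0 ?subr_eq0.
Qed.

Definition lip0_pred : {pred V -> R^o} :=
  fun f => `[< lipschitz f /\ f 0 = 0 >].

Lemma lip0_submod_closed : submod_closed lip0_pred.
Proof.
split=> [|a f g /asboolP[/lipschitzP[c fc] f0] /asboolP[/lipschitzP[d gd] g0]].
  apply/asboolP; split=> //; apply/lipschitzP; exists 0 => x y.
  by rewrite subrr normr0 mul0r.
apply/asboolP; split; last by rewrite /= !fctE f0 g0 scaler0 addr0.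
apply/lipschitzP; exists (`|a| * c + d) => x y.
rewrite !fctE opprD addrACA -scalerBr mulrDl (le_trans (ler_normD _ _))//.
by rewrite lerD// normrZ -mulrA ler_wpM2l.
Qed.

HB.instance Definition _ :=
  GRing.isSubmodClosed.Build R (V -> R^o) lip0_pred lip0_submod_closed.

Definition Lip0 : Type := submod lip0_pred.
HB.instance Definition _ := GRing.SubLmodule.on Lip0.

Definition lip0_fun (f : Lip0) : V -> R^o := val f.

Lemma lip0_lipschitz (f : Lip0) : lipschitz (lip0_fun f).
Proof. by have /asboolP[] := valP f. Qed.

Lemma lip0_at0 (f : Lip0) : lip0_fun f 0 = 0.
Proof. by have /asboolP[] := valP f. Qed.

Lemma lip0_funD (f g : Lip0) x :
  lip0_fun (f + g) x = lip0_fun f x + lip0_fun g x.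
Proof. by []. Qed.

Lemma lip0_funZ (a : R) (f : Lip0) x : lip0_fun (a *: f) x = a * lip0_fun f x.
Proof. by []. Qed.

Let nrm (f : Lip0) : R := lip_norm (lip0_fun f).

Let nrmD (f g : Lip0) : nrm (f + g) <= nrm f + nrm g.
Proof.
apply: lip_norm_le => [|x y]; first by rewrite addr_ge0 ?lip_norm_ge0.
rewrite !lip0_funD opprD addrACA mulrDl.
by rewrite (le_trans (ler_normD _ _))// lerD// lip_norm_ub//; exact: lip0_lipschitz.
Qed.

Let nrmZ_le (a : R) (f : Lip0) : nrm (a *: f) <= `|a| * nrm f.
Proof.
apply: lip_norm_le => [|x y]; first by rewrite mulr_ge0 ?lip_norm_ge0.
rewrite !lip0_funZ -mulrBr normrM -mulrA ler_wpM2l//.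
by rewrite lip_norm_ub//; exact: lip0_lipschitz.
Qed.

Let nrmZ (a : R) (f : Lip0) : nrm (a *: f) = `|a| * nrm f.
Proof.
apply/eqP; rewrite eq_le nrmZ_le/=; have [->|a0] := eqVneq a 0.
  by rewrite normr0 mul0r lip_norm_ge0.
rewrite -ler_pdivlMl ?normr_gt0// -normfV.
by rewrite -[X in nrm X <= _](scalerK a0) nrmZ_le.
Qed.

Let nrm0_eq0 (f : Lip0) : nrm f = 0 -> f = 0.
Proof.
move=> f0; apply: val_inj; apply/funext => x; rewrite raddf0.
have := lip_norm_ub x 0 (lip0_lipschitz f).
rewrite -/(nrm f) f0 mul0r lip0_at0 subr0 normr_le0 => /eqP; exact.
Qed.

HB.instance Definition _ := Lmodule_isNormed.Build R Lip0 nrmD nrmZ nrm0_eq0.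

Lemma normr_Lip0 (f : Lip0) : `|f| = lip_norm (lip0_fun f).
Proof. by []. Qed.

End LipschitzNorm.

Section OperatorNorm.
Context (R : realType) (V W : normedModType R).

(* Meaningful for continuous linear maps only: sup of an unbounded set is 0. *)
Definition op_norm (f : V -> W) : R :=
  sup [set `|f x| | x in [set x : V | `|x| <= 1]].

Lemma op_norm_ge0 f : 0 <= op_norm f.
Proof. by apply: sup_nonneg => _ [x _ <-]. Qed.

Lemma op_norm_ub (f : {linear V -> W}) x :
  continuous f -> `|f x| <= op_norm f * `|x|.
Proof.
move=> /linear_lipschitz[k k0 fk].
have [->|x0] := eqVneq x 0; first by rewrite linear0 !normr0 mulr0.
rewrite -ler_pdivrMr ?normr_gt0//; apply: ub_le_sup; last first.
  exists (`|x|^-1 *: x); first by rewrite /= normfZV.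
  by rewrite linearZ/= normrZ normfV normr_id mulrC.
exists k => _ [u /= u1 <-].
by rewrite (le_trans (fk u))// ler_piMr// ltW.
Qed.

Lemma op_norm_le (f : V -> W) c :
  0 <= c -> (forall x, `|f x| <= c * `|x|) -> op_norm f <= c.
Proof.
move=> c0 fc; apply: ge_sup => [|_ [u /= u1 <-]].
  by exists `|f 0|, 0 => //=; rewrite normr0.
by rewrite (le_trans (fc u))// ler_piMr.
Qed.

End OperatorNorm.

Section Dual.
Context (R : realType) (V : normedModType R).

Definition dual_pred : {pred V -> R^o} :=
  fun f => `[< linear f /\ continuous f >].

Lemma dual_submod_closed : submod_closed dual_pred.
Proof.
split=> [|a f g /asboolP[fl fc] /asboolP[gl gc]].
  apply/asboolP; split=> [b x y|].
    by rewrite -[LHS]/(0 : R^o) -[RHS]/(b *: 0 + 0 : R^o) scaler0 addr0.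
  exact: cst_continuous.
apply/asboolP; split=> [b x y|x].
  rewrite !fctE fl gl !scalerDr !scalerA [b * a]mulrC -!addrA; congr (_ + _).
  by rewrite addrCA.
apply: (@cvgD _ _ _ _ _ (a *: f) g); last exact: gc.
exact: cvgZl_tmp (fc x).
Qed.

HB.instance Definition _ :=
  GRing.isSubmodClosed.Build R (V -> R^o) dual_pred dual_submod_closed.

Definition dual : Type := submod dual_pred.
HB.instance Definition _ := GRing.SubLmodule.on dual.

Definition dual_fun (f : dual) : V -> R^o := val f.

Lemma dual_fun_linear (f : dual) : linear (dual_fun f).
Proof. by have /asboolP[] := valP f. Qed.

HB.instance Definition _ (f : dual) :=
  GRing.isLinear.Build R V R^o *:%R (dual_fun f) (dual_fun_linear f).

Lemma dual_continuous (f : dual) : continuous (dual_fun f).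
Proof. by have /asboolP[] := valP f. Qed.

Lemma dual_funD (f g : dual) x :
  dual_fun (f + g) x = dual_fun f x + dual_fun g x.
Proof. by []. Qed.

Lemma dual_funZ (a : R) (f : dual) x : dual_fun (a *: f) x = a * dual_fun f x.
Proof. by []. Qed.

Let nrm (f : dual) : R := op_norm (dual_fun f).

Let nrmD (f g : dual) : nrm (f + g) <= nrm f + nrm g.
Proof.
apply: op_norm_le => [|x]; first by rewrite addr_ge0 ?op_norm_ge0.
rewrite dual_funD mulrDl (le_trans (ler_normD _ _))// lerD//.
  exact/op_norm_ub/dual_continuous.
exact/op_norm_ub/dual_continuous.
Qed.

Let nrmZ_le (a : R) (f : dual) : nrm (a *: f) <= `|a| * nrm f.
Proof.
apply: op_norm_le => [|x]; first by rewrite mulr_ge0 ?op_norm_ge0.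
rewrite dual_funZ normrM -mulrA ler_wpM2l//.
exact/op_norm_ub/dual_continuous.
Qed.

Let nrmZ (a : R) (f : dual) : nrm (a *: f) = `|a| * nrm f.
Proof.
apply/eqP; rewrite eq_le nrmZ_le/=; have [->|a0] := eqVneq a 0.
  by rewrite normr0 mul0r op_norm_ge0.
rewrite -ler_pdivlMl ?normr_gt0// -normfV.
by rewrite -[X in nrm X <= _](scalerK a0) nrmZ_le.
Qed.

Let nrm0_eq0 (f : dual) : nrm f = 0 -> f = 0.
Proof.
move=> f0; apply: val_inj; apply/funext => x; rewrite raddf0.
have := op_norm_ub x (@dual_continuous f).
rewrite -/(nrm f) f0 mul0r normr_le0 => /eqP; exact.
Qed.

HB.instance Definition _ := Lmodule_isNormed.Build R dual nrmD nrmZ nrm0_eq0.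

Lemma normr_dual (f : dual) : `|f| = op_norm (dual_fun f).
Proof. by []. Qed.

End Dual.

Section Complementation.
Context (R : realType) (X : normedModType R).

Definition finite_dimensional (V : lmodType R) : Prop :=
  exists (n : nat) (e : 'I_n -> V),
    forall v : V, exists a : 'I_n -> R, v = \sum_i a i *: e i.

Definition locally_complemented (Y : submodClosed X) : Prop :=
  exists2 c : R, 0 < c &
    forall M : submodClosed X, finite_dimensional (submod M) ->
      exists f : {linear submod M -> submod Y},
        [/\ continuous f, op_norm f <= c &
            forall x : submod M, val x \in (Y : {pred X}) -> val (f x) = val x].

Definition lipschitz_retract (B : set X) : Prop :=
  exists r : X -> X,
    [/\ forall x, B (r x), lipschitz r & forall x, B x -> r x = x].

Definition lip_extension (Y : submodClosed X)
    (L : {linear Lip0 (submod Y) -> Lip0 X}) : Prop :=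
  continuous L /\ forall g (y : submod Y), lip0_fun (L g) (val y) = lip0_fun g y.

Definition dual_extension (Y : submodClosed X)
    (G : {linear dual (submod Y) -> dual X}) : Prop :=
  continuous G /\ forall g (y : submod Y), dual_fun (G g) (val y) = dual_fun g y.

End Complementation.

(* Main.v *)
Require Import Defs.
From HB Require Import structures.
From mathcomp Require Import all_boot all_order all_algebra.
From mathcomp Require Import finmap.
From mathcomp Require Import all_classical all_reals all_analysis.
From mathcomp Require Import ring lra.
Set Implicit Arguments.
Unset Strict Implicit.
Unset Printing Implicit Defensive.
Import Order.TTheory GRing.Theory Num.Theory.
Import numFieldNormedType.Exports.
Local Open Scope classical_set_scope.
Local Open Scope ring_scope.

(** The implications are
    Lipschitz retract => extension of Lip_0(Y) => extension of Y^*,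
    and the latter is equivalent to local complementation.

    From Lipschitz functions to functionals.  The map L sends a functional g on
    Y to a Lipschitz function F on X that agrees with g on Y but need not be
    linear.  Averaging the increments of F, first over translations by Y and
    then over translations by X,
      G g x = mean_(z in X) mean_(y in Y) (F (x + z + y) - F (z + y)),
    makes it additive, hence linear since it is bounded; it depends linearly on
    F, and the inner mean over Y makes it equal to g on Y.  The means exist
    because abelian groups are amenable ([invariant_mean_exists]).

    From functionals to local complementation.  Let M be finite dimensional.
    Extending the identity of the intersection of M and Y to a map M -> Y of
    controlled norm amounts to choosing finitely many vectors y_l of Y (the
    images of a complement) so that finitely many vectors v_j + sum_l beta_jl
    y_l are small: one vector for each point of a finite net in the unit ball
    of M.  By Helly's theorem ([helly], a consequence of Hahn-Banach) the only
    obstruction is a family of functionals psi_j on Y with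
    sum_j beta_jl psi_j = 0 for all l for which sum_j psi_j (v_j) is large
    compared with sum_j |psi_j|.  But applying G to these relations shows that
    sum_j psi_j (v_j) = sum_j (G psi_j)(m_j), where the m_j are the points of
    the net; this is at most the norm of G times sum_j |psi_j|.  The resulting
    bound does not depend on M.

    From local complementation to functionals.  Compose g with the maps
    f_M : M -> Y and pass to the limit along an ultrafilter finer than the
    inclusion order on finite subsets of X.

    A Lipschitz retraction r extends Lipschitz functions by composition. *)

(** * Sublinear functionals and the Hahn-Banach theorem *)

Section HahnBanach.
Context (R : realType) (V : lmodType R).
Implicit Types (p q : V -> R) (x y z : V) (t c : R).

Definition sublinear p :=
  (forall x y, p (x + y) <= p x + p y) /\
  (forall t x, 0 < t -> p (t *: x) <= t * p x).

Lemma sublinear0 p : sublinear p -> p 0 = 0.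
Proof.
move=> [pD pZ]; apply/eqP; rewrite eq_le; apply/andP; split.
  by have := pZ 2^-1 0; rewrite scaler0 invr_gt0 => /(_ (ltr0Sn _ _)); lra.
by have := pD 0 0; rewrite addr0; lra.
Qed.

Lemma sublinearZ p t x : sublinear p -> 0 <= t -> p (t *: x) = t * p x.
Proof.
move=> ps; rewrite le_eqVlt => /predU1P[<-|t0].
  by rewrite scale0r mul0r sublinear0.
apply/eqP; rewrite eq_le ps.2//= -ler_pdivlMl//.
have := ps.2 t^-1 (t *: x); rewrite invr_gt0 scalerK ?gt_eqF//; exact.
Qed.

Lemma sublinear_lb p x : sublinear p -> - p (- x) <= p x.
Proof. by move=> ps; have := ps.1 x (- x); rewrite subrr sublinear0//; lra. Qed.

(** For a sublinear p, the largest sublinear q below p such that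
    q (y + t x) = q y + t p x for all real t. *)
Definition tilt p x y : R :=
  inf [set p (y + t *: x) - t * p x | t in [set t : R | 0 <= t]].

Lemma tilt_le p x y t : sublinear p -> 0 <= t ->
  tilt p x y <= p (y + t *: x) - t * p x.
Proof.
move=> ps t0; apply: ge_inf; last by exists t.
exists (- p (- y)) => _ [s /= s0 <-].
have := ps.1 (y + s *: x) (- y); rewrite addrAC subrr add0r sublinearZ//; lra.
Qed.

Lemma tilt_ge p x y c :
  (forall t, 0 <= t -> c <= p (y + t *: x) - t * p x) -> c <= tilt p x y.
Proof.
move=> pc; apply: lb_le_inf; last by move=> _ [t /= t0 <-]; exact: pc.
by exists (p (y + 0 *: x) - 0 * p x), 0 => /=.
Qed.

Lemma tilt_sublinear p x : sublinear p -> sublinear (tilt p x).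
Proof.
move=> ps; split=> [y z|t y t0].
  rewrite -lerBlDr; apply: tilt_ge => s s0.
  rewrite lerBlDl -lerBlDr; apply: tilt_ge => t t0.
  have := tilt_le x (y + z) ps (addr_ge0 s0 t0).
  by have := ps.1 (y + s *: x) (z + t *: x); rewrite addrACA -scalerDl; lra.
rewrite -ler_pdivrMl//; apply: tilt_ge => s s0; rewrite ler_pdivrMl//.
have := tilt_le x (t *: y) ps (mulr_ge0 (ltW t0) s0).
rewrite -scalerA -scalerDr (sublinearZ _ ps (ltW t0)).
by rewrite mulrBr mulrA.
Qed.

Lemma tilt_le_id p x y : sublinear p -> tilt p x y <= p y.
Proof.
by move=> ps; have := tilt_le x y ps (lexx 0); rewrite scale0r addr0; lra.
Qed.

Lemma tilt_opp p x : sublinear p -> tilt p x (- x) <= - p x.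
Proof.
move=> ps; have := tilt_le x (- x) ps ler01.
by rewrite scale1r addNr sublinear0//; lra.
Qed.

(** A chain of sublinear functionals below p is bounded below pointwise by
    - p (- x), so its pointwise infimum is finite, and it is subadditive because
    two members of a chain can be replaced by the smaller one. *)
Lemma minimal_sublinear p : sublinear p ->
  exists q, [/\ sublinear q, forall x, q x <= p x &
    forall q', sublinear q' -> (forall x, q' x <= q x) -> q' = q].
Proof.
move=> ps.
pose T := {q : V -> R | sublinear q /\ forall x, q x <= p x}.
pose below (q q' : T) := `[< forall x, sval q' x <= sval q x >].
have [|r s t /asboolP rs /asboolP st|s t /asboolP st /asboolP ts|A Atot|
  [q [qs qp]] qmin] := @Zorn T below.
- by move=> t; apply/asboolP.
- by apply/asboolP => x; exact: le_trans (rs x).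
- case: s t st ts => [s ?] [t ?] /= st ts.
  by apply: eq_exist; apply/funext => x; apply/eqP; rewrite eq_le st ts.
- have [A0|/set0P[q0 Aq0]] := eqVneq A set0.
    have pT : sublinear p /\ forall x, p x <= p x by [].
    by exists (exist _ p pT) => s; rewrite A0.
  pose m x := inf [set sval q x | q in A].
  have m_le (q : T) x : A q -> m x <= sval q x.
    move=> Aq; apply: ge_inf; last by exists q.
    exists (- p (- x)) => _ [[r [rs rp]] /= Ar <-].
    by have := sublinear_lb x rs; have := rp (- x); lra.
  have m_ge x c : (forall q : T, A q -> c <= sval q x) -> c <= m x.
    move=> cA; apply: lb_le_inf; first by exists (sval q0 x), q0.
    by move=> _ [q Aq <-]; exact: cA.
  have mT : sublinear m /\ forall x, m x <= p x.
    split; last by move=> x; apply: le_trans (m_le _ _ Aq0) _; exact: (svalP q0).2.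
    split=> [x y|t x t0]; last first.
      rewrite -ler_pdivrMl//; apply: m_ge => q Aq; rewrite ler_pdivrMl//.
      apply: le_trans (m_le q _ Aq) _; exact: (svalP q).1.2.
    rewrite -lerBlDr; apply: (m_ge) => q Aq; rewrite lerBlDl -lerBlDr.
    apply: m_ge => r Ar; rewrite lerBlDl.
    have [/asboolP qr|/asboolP rq] := Atot _ _ Aq Ar.
      have := m_le r (x + y) Ar; have := (svalP r).1.1 x y; have := qr x; lra.
    have := m_le q (x + y) Aq; have := (svalP q).1.1 x y; have := rq y; lra.
  by exists (exist _ m mT) => q Aq; apply/asboolP => x; exact: m_le.
exists q; split=> // q' q's q'q.
have q'T : sublinear q' /\ forall x, q' x <= p x.
  by split=> // x; exact: le_trans (q'q x) _.
exact: (congr1 sval (qmin (exist _ q' q'T) (asboolT q'q))).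
Qed.

(** A minimal sublinear functional equals each of its tilts, which makes it odd,
    hence linear.  Starting from the tilt of p along x0 rather than from p
    itself forces the value at x0. *)
Lemma hahn_banach p x0 : sublinear p ->
  exists l : {linear V -> R^o}, (forall x, l x <= p x) /\ l x0 = p x0.
Proof.
move=> ps; have [q [qs qt qmin]] := minimal_sublinear (tilt_sublinear x0 ps).
have qN x : q (- x) = - q x.
  have qE := qmin _ (tilt_sublinear x qs) (fun y => tilt_le_id x y qs).
  have := tilt_opp x qs; rewrite qE => qN.
  by apply/eqP; rewrite eq_le qN/=; have := sublinear_lb x qs; lra.
have qD x y : q (x + y) = q x + q y.
  apply/eqP; rewrite eq_le qs.1/=.
  by have := qs.1 (x + y) (- y); rewrite addrK qN; lra.
have ql : linear (q : V -> R^o).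
  move=> a x y; rewrite qD; congr (_ + _).
  have [a0|/ltW a0] := leP 0 a; first exact: sublinearZ.
  by rewrite -{1}[a]opprK scaleNr qN (sublinearZ _ qs) ?oppr_ge0// mulNr opprK.
pose ql' := GRing.isLinear.Build _ _ _ _ _ ql.
pose l : {linear V -> R^o} := HB.pack (q : V -> R^o) ql'.
exists l; split=> [x|] /=.
  exact: le_trans (qt x) (tilt_le_id x0 x ps).
apply/eqP; rewrite eq_le (le_trans (qt x0) (tilt_le_id x0 x0 ps))/=.
by have := qt (- x0); have := tilt_opp x0 ps; rewrite qN; lra.
Qed.

End HahnBanach.

(** * Bounded linear functionals *)

Section BoundedLinear.
Context (R : realType).

Lemma bounded_continuous (V W : normedModType R) (f : {linear V -> W}) (c : R) :
  (forall x, `|f x| <= c * `|x|) -> continuous f.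
Proof.
move=> fc; apply/linear_bounded_continuous/bounded_funP => r.
exists (`|c| * r) => x xr; apply: le_trans (fc x) _.
apply: le_trans (ler_norm _) _; rewrite normrM normr_id.
by rewrite ler_wpM2l.
Qed.

Lemma bounded_linear_dual (V : normedModType R) (f : V -> R^o) (c : R) :
  linear f -> 0 <= c -> (forall x, `|f x| <= c * `|x|) ->
  exists2 psi : dual V, dual_fun psi = f & `|psi| <= c.
Proof.
move=> fl c0 fc.
pose fL : {linear V -> R^o} := HB.pack f (GRing.isLinear.Build _ _ _ _ _ fl).
have fP : f \in @dual_pred R V.
  by apply/asboolP; split=> //; exact: (@bounded_continuous _ _ fL c).
by exists (Submod fP) => //; rewrite normr_dual; exact: op_norm_le.
Qed.

Lemma dual_fun_sum (V : normedModType R) I (s : seq I) (P : pred I)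
    (psi : I -> dual V) x :
  dual_fun (\sum_(i <- s | P i) psi i) x = \sum_(i <- s | P i) dual_fun (psi i) x.
Proof. by apply: (big_morph (fun f => dual_fun f x)). Qed.

Lemma dual_norming (V : normedModType R) (psi : dual V) (e : R) : 0 < e ->
  exists2 y : V, `|y| <= 1 & `|psi| - e < dual_fun psi y.
Proof.
move=> e0; rewrite normr_dual.
have [| _ [y /= y1 <-]] := @sup_adherent R _ e e0 (_ : has_sup
    [set `|dual_fun psi x| | x in [set x : V | `|x| <= 1]]).
  split; first by exists `|dual_fun psi 0|, 0 => //=; rewrite normr0.
  exists (op_norm (dual_fun psi)) => _ [x /= x1 <-].
  apply: le_trans (op_norm_ub x (@dual_continuous _ _ psi)) _.
  by rewrite ler_piMr ?op_norm_ge0.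
rewrite -/(op_norm _) => ey.
have [y0|y0] := leP 0 (dual_fun psi y).
  by exists y => //; move: ey; rewrite ger0_norm.
by exists (- y); rewrite ?normrN// linearN; move: ey; rewrite ltr0_norm.
Qed.

End BoundedLinear.

(** * Helly's theorem *)

Section Helly.
Context (R : realType) (Y : normedModType R) (r n : nat).
Variables (beta : 'I_r -> 'I_n -> R).
Implicit Types (u : 'I_r -> Y) (y : 'I_n -> Y).

Let shift u y (j : 'I_r) : Y := u j + \sum_l beta j l *: y l.

Let reach u : set R :=
  [set c | 0 <= c /\ exists y, forall j, `|shift u y j| <= c].

(** The quotient seminorm of the sup norm on the r-tuples of vectors of Y, modulo
    the tuples of the form (sum_l beta j l *: y l)_j. *)
Definition coset_norm u : R := inf (reach u).

Let reach_neq0 u : reach u !=set0.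
Proof.
exists (\sum_j `|u j|); split; first exact: sumr_ge0.
exists (fun=> 0) => j; rewrite /shift big1 ?addr0 => [|l _]; last exact: scaler0.
by rewrite (bigD1 j)//= lerDl sumr_ge0.
Qed.

Lemma coset_norm_le u y (c : R) :
  0 <= c -> (forall j, `|shift u y j| <= c) -> coset_norm u <= c.
Proof.
by move=> c0 uc; apply: ge_inf; [exists 0 => ? [] | split=> //; exists y].
Qed.

Lemma coset_norm_lt u (c : R) : coset_norm u < c ->
  exists y, forall j, `|shift u y j| <= c.
Proof.
move=> uc.
have reach_inf : has_inf (reach u) by split=> //; exists 0 => ? [].
have cu : 0 < c - coset_norm u by rewrite subr_gt0.
have [d [d0 [y yd]]] := inf_adherent cu reach_inf.
rewrite addrC subrK => dc.
by exists y => j; exact: le_trans (ltW dc).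
Qed.

Lemma coset_norm_sublinear : sublinear coset_norm.
Proof.
split=> [u v|t u t0].
  rewrite -lerBlDr; apply: lb_le_inf => // a [a0 [y ya]].
  rewrite lerBlDl -lerBlDr; apply: lb_le_inf => // b [b0 [z zb]].
  rewrite lerBlDl; apply: (@coset_norm_le _ (y + z)); first exact: addr_ge0.
  move=> j; apply: le_trans (lerD (ya j) (zb j)).
  apply: le_trans (ler_normD _ _); rewrite /shift addrACA -big_split/=.
  by under [X in _ <= `|_ + X|]eq_bigr do rewrite -scalerDr.
rewrite -ler_pdivrMl//; apply: lb_le_inf => // a [a0 [y ya]].
rewrite ler_pdivrMl//; apply: (@coset_norm_le _ (t *: y)).
  by rewrite mulr_ge0// ltW.
move=> j; apply: le_trans (ler_wpM2l (ltW t0) (ya j)).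
have -> : shift (t *: u) (t *: y) j = t *: shift u y j.
  rewrite /shift scalerDr scaler_sumr; congr (_ + _); apply: eq_bigr => l _.
  by rewrite fctE !scalerA mulrC.
by rewrite normrZ gtr0_norm.
Qed.

Let single j (x : Y) : 'I_r -> Y := fun i => if i == j then x else 0.

Let single_linear j : linear (single j).
Proof.
move=> a x y; apply/funext => i; rewrite /single !fctE.
by case: eqP => // _; rewrite scaler0 addr0.
Qed.

Let sum_single u : \sum_j single j (u j) = u.
Proof.
apply/funext => i; rewrite fct_sumE (bigD1 i)//= {1}/single eqxx.
by rewrite big1 ?addr0// => j ji; rewrite /single eq_sym (negPf ji).
Qed.

(** Hahn-Banach gives a functional below the quotient seminorm that attains it at
    v.  Its restrictions psi j to the coordinates satisfy the linear relations
    because the functional vanishes on the subspace that is divided out, and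
    their norms add up to at most 1 because the dual of a finite sup-norm
    product is the l1-product of the duals. *)
Theorem helly (v : 'I_r -> Y) (c c' : R) : 0 <= c -> c < c' ->
  (forall psi : 'I_r -> dual Y, (forall l, \sum_j beta j l *: psi j = 0) ->
    \sum_j dual_fun (psi j) (v j) <= c * \sum_j `|psi j|) ->
  exists y : 'I_n -> Y, forall j, `|v j + \sum_l beta j l *: y l| <= c'.
Proof.
move=> c0 cc' vc; apply: coset_norm_lt; apply: le_lt_trans cc'.
have [F [Fle <-]] := hahn_banach v coset_norm_sublinear.
have F_le u d : 0 <= d -> (forall j, `|u j| <= d) -> F u <= d.
  move=> d0 ud; apply: le_trans (Fle u) (coset_norm_le (y := fun=> 0) d0 _).
  by move=> j; rewrite /shift big1 ?addr0// => l _; rewrite scaler0.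
have Fsingle_le j x : F (single j x) <= `|x|.
  by apply: F_le => // i; rewrite /single; case: eqP; rewrite ?normr0.
have Fsingle_linear j : linear (fun x => F (single j x) : R^o).
  by move=> a x y; rewrite single_linear linearP.
have /choice[psi psiP] j : exists psi : dual Y,
    dual_fun psi = (fun x => F (single j x)).
  have [x|psi psiE _] := bounded_linear_dual (Fsingle_linear j) ler01.
    rewrite mul1r ler_norml Fsingle_le andbT lerNl.
    have := Fsingle_le j (- x); rewrite normrN -scaleN1r.
    have -> : single j (-1 *: x) = - single j x.
      apply/funext => i; rewrite /single scaleN1r -[RHS]/(- (if _ then _ else _)).
      by case: eqP; rewrite ?oppr0.
    by rewrite linearN.
  by exists psi.
have FE u : F u = \sum_j dual_fun (psi j) (u j).
  by rewrite -{1}(sum_single u) linear_sum; apply: eq_bigr => j _; rewrite psiP.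
have psi_rel l : \sum_j beta j l *: psi j = 0.
  have le0 (y : Y) : \sum_j beta j l * dual_fun (psi j) y <= 0.
    have -> : \sum_j beta j l * dual_fun (psi j) y = F (fun j => beta j l *: y).
      by rewrite FE; apply: eq_bigr => j _; rewrite linearZ.
    apply: le_trans (Fle _) _.
    apply: (coset_norm_le (y := fun i => if i == l then - y else 0)) => // j.
    rewrite /shift (bigD1 l)//= eqxx big1 ?addr0; last first.
      by move=> i /negPf ->; rewrite scaler0.
    by rewrite scalerN subrr normr0.
  apply: val_inj; apply/funext => y; rewrite raddf0.
  rewrite -[LHS]/(dual_fun _ y) dual_fun_sum; apply/eqP.
  rewrite eq_le le0/= -oppr_le0 -sumrN; apply: le_trans (le0 (- y)).
  by rewrite ler_sum// => j _; rewrite linearN mulrN.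
have psi_norm : \sum_j `|psi j| <= 1.
  apply/ler_addgt0Pr => e e0.
  (* nearly norming vectors, with errors that add up to at most e *)
  have r0 : 0 < e / r.+1%:R by rewrite divr_gt0.
  have /choice[y yP] j : exists y : Y,
      `|y| <= 1 /\ `|psi j| - e / r.+1%:R < dual_fun (psi j) y.
    by have [y] := dual_norming (psi j) r0; exists y.
  have Fy : F y <= 1 by apply: F_le => // j; case: (yP j).
  apply: (@le_trans _ _ (\sum_j (dual_fun (psi j) (y j) + e / r.+1%:R))).
    by apply: ler_sum => j _; have [_ /ltW] := yP j; rewrite lerBlDr.
  rewrite big_split/= -FE lerD// sumr_const card_ord -[_ *+ r]mulr_natr.
rewrite mulrAC ler_pdivrMr// ler_pM2l// ler_nat.
  exact: leqnSn.
rewrite FE; apply: le_trans (vc _ psi_rel) _.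
by rewrite ler_piMr.
Qed.
End Helly.

(** * Finite-dimensional spaces *)

Section FiniteDimension.
Context (R : realType).

(** K is the row space of a matrix of maximal rank among those whose row space
    lies in K, and the pseudo-inverse of this matrix gives the projection. *)
Lemma subspace_projection (n : nat) (K : set 'rV[R]_n) :
  K 0 -> (forall c a b, K a -> K b -> K (c *: a + b)) ->
  exists P : 'M[R]_n, (forall a, K (a *m P)) /\ (forall a, K a -> a *m P = a).
Proof.
move=> K0 Klin.
pose inK (A : 'M[R]_n) := forall a : 'rV_n, (a <= A)%MS -> K a.
pose rk k := `[< exists2 A, inK A & \rank A = k >].
have rk_ex : exists k, rk k.
  exists 0%N; apply/asboolP; exists 0; last exact: mxrank0.
  by move=> a; rewrite submx0 => /eqP ->.
have rk_le k : rk k -> (k <= n)%N.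
  by move=> /asboolP[A _ <-]; exact: rank_leq_row.
have [_ /asboolP[A AK <-] Amax] := ex_maxnP rk_ex rk_le.
have KA (a : 'rV_n) : K a -> (a <= A)%MS.
  move=> Ka; apply: contraT => aA.
  have /Amax : rk (\rank (A + a)%MS).
    apply/asboolP; exists (A + a)%MS => // b /sub_addsmxP[[u v] /= ->].
    rewrite addrC [v]mx11_scalar mul_scalar_mx.
    by apply: Klin => //; apply/AK/submxMl.
  rewrite leqNgt => /negP[].
  have : (A < A + a)%MS.
    rewrite ltmxE addsmxSl/=; apply: contraNN aA.
    exact: submx_trans (addsmxSr _ _).
  by rewrite ltmxErank => /andP[].
exists (pinvmx A *m A); split=> a; first by rewrite mulmxA; apply/AK/submxMl.
by move=> /KA aA; rewrite mulmxA mulmxKpV.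
Qed.

Lemma rV_linear_continuous (n : nat) (V : normedModType R)
  (f : {linear 'rV[R]_n -> V}) : continuous f.
Proof.
apply: (@bounded_continuous _ _ _ _ (\sum_i `|f 'e_i|)) => a.
rewrite {1}(row_sum_delta a) linear_sum mulr_suml.
apply: le_trans (ler_norm_sum _ _ _) _; apply: ler_sum => i _.
rewrite linearZ/= normrZ mulrC ler_wpM2l//.
rewrite [leRHS]/Num.norm /= mx_normrE; exact: (bigmax_sup (ord0, i)).
Qed.

(** The images of f are vectors with bounded coordinates even though f may have a
    kernel: on a complement of the kernel f is injective, so that |f| has a
    positive minimum on the compact unit sphere of the complement. *)
Lemma coordinates_bounded (n : nat) (V : normedModType R)
    (f : {linear 'rV[R]_n -> V}) :
  exists2 C : R, 0 <= C &
    forall a, exists2 b, f b = f a & `|b| <= C * `|f a|.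
Proof.
have [||P [PK KP]] := @subspace_projection n [set a | f a = 0].
- exact: linear0.
- by move=> c a b /= fa fb; rewrite linearP fa fb scaler0 addr0.
pose S := [set a : 'rV[R]_n | `|a *m P| = 0 /\ `|a| = 1].
have fB a : f (a - a *m P) = f a by rewrite linearB (PK a) subr0.
have BP (a : 'rV_n) : (a - a *m P) *m P = 0 by rewrite mulmxBl (KP _ (PK a)) subrr.
have [S0|/set0P S0] := eqVneq S set0.
  exists 0 => // a; exists 0; last by rewrite normr0 mul0r.
  have [a0|a0] := eqVneq (a - a *m P) 0; first by rewrite -(fB a) a0.
  have : S (`|a - a *m P|^-1 *: (a - a *m P)).
    by split; [rewrite -scalemxAl BP scaler0 normr0 | rewrite normfZV].
  by rewrite S0.
have Scompact : compact S.
  apply: bounded_closed_compact.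
    exists 1; split; first exact: num_real.
    by move=> x x1 a [_ a1] /=; rewrite a1 ltW.
  apply: closedI.
    apply: ((continuous_closedP (fun a => `|mulmxr P a|)).1 _ [set x : R | x = 0]);
      last exact: closed_eq.
    move=> a; apply: continuous_comp; last exact: norm_continuous.
    exact: rV_linear_continuous.
  apply: ((continuous_closedP _).1 _ [set x : R | x = 1]); last exact: closed_eq.
  exact: norm_continuous.
have [|b /set_mem [/normr0_eq0 bP b1] bmin] :=
    @compact_EVT_min _ R (fun a => `|f a|) S S0 Scompact.
  apply: continuous_subspaceT => a.
  apply: continuous_comp; last exact: norm_continuous.
  exact: rV_linear_continuous.
have fb : 0 < `|f b|.
  rewrite normr_gt0; apply/eqP => /KP; rewrite bP => b0.
  by move/eqP: b1; rewrite -b0 normr0 eq_sym oner_eq0.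
exists `|f b|^-1 => [|a]; first by rewrite invr_ge0.
exists (a - a *m P); first exact: fB.
have [->|a0] := eqVneq (a - a *m P) 0; first by rewrite normr0 mulr_ge0 ?invr_ge0.
rewrite ler_pdivlMl// -(fB a).
have := bmin (`|a - a *m P|^-1 *: (a - a *m P)).
rewrite linearZ/= normrZ normfV normr_id ler_pdivlMl ?normr_gt0// mulrC; apply.
by apply/mem_set; split; [rewrite -scalemxAl BP scaler0 normr0 | rewrite normfZV].
Qed.

(** The vectors f (a j) form a finite e-net, inside the unit ball, of the unit
    ball of the range of f: the latter is the image of a compact set. *)
Lemma unit_ball_net (n : nat) (V : normedModType R)
    (f : {linear 'rV[R]_n -> V}) (e : R) : 0 < e ->
  exists r (a : 'I_r -> 'rV[R]_n), (forall j, `|f (a j)| <= 1) /\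
    forall x, `|f x| <= 1 -> exists j, `|f x - f (a j)| <= e.
Proof.
move=> e0; have [C C0 fC] := coordinates_bounded f.
pose A := [set a : 'rV[R]_n | `|a| <= C /\ `|f a| <= 1].
have fnorm : continuous (fun a => `|f a|).
  move=> a; apply: continuous_comp; last exact: norm_continuous.
  exact: rV_linear_continuous.
have Acompact : compact A.
  apply: bounded_closed_compact.
    exists C; split; first exact: num_real.
    by move=> x Cx a [/le_trans aC _]; apply/aC/ltW.
  apply: closedI.
    apply: ((continuous_closedP _).1 _ [set x : R | x <= C]); last exact: closed_le.
    exact: norm_continuous.
  by apply: ((continuous_closedP _).1 _ [set x : R | x <= 1]); last exact: closed_le.
move: Acompact; rewrite compact_cover.
move=> /(_ _ A (fun a => [set b | `|f b - f a| < e])) [|a Aa|D DA Dcover].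
- move=> a _; pose fa b := f b - f a.
  apply: (@open_comp _ _ (fun b => `|fa b|) [set x : R | x < e]);
    last exact: open_lt.
  move=> b _; apply: (@continuous_comp _ _ _ fa (fun y => `|y|));
    last exact: norm_continuous.
  exact: (cvgB (@rV_linear_continuous _ _ f b) (cvg_cst _)).
- by exists a => //=; rewrite subrr normr0.
exists (size D), (fun j => nth 0 D j).
split=> [j|x fx].
  have : nth 0 D j \in D by exact: mem_nth.
  by move=> /DA /set_mem[].
have [b fb bC] := fC x; rewrite -fb.
have [|a /= aD ba] := Dcover b.
  split; last by rewrite fb.
  by apply: le_trans bC _; rewrite ler_piMr.
have aD' : (index a D < size D)%N by rewrite index_mem.
by exists (Ordinal aD'); rewrite /= nth_index// ltW.
Qed.

End FiniteDimension.

Section LinearMapsOnFiniteDimension.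
Context (R : realType).

Lemma finite_dimensional_rV (V : lmodType R) : finite_dimensional V ->
  exists n (f : {linear 'rV[R]_n -> V}), forall x, exists a, f a = x.
Proof.
move=> [n [e span_e]]; pose f (a : 'rV[R]_n) : V := \sum_i a 0 i *: e i.
have f_linear : linear f.
  move=> c a b; rewrite /f scaler_sumr -big_split; apply: eq_bigr => i _ /=.
  by rewrite !mxE scalerDl scalerA.
pose fL : {linear 'rV[R]_n -> V} :=
  HB.pack f (GRing.isLinear.Build _ _ _ _ _ f_linear).
exists n, fL => x.
have [a ->] := span_e x; exists (\row_i a i).
by apply: eq_bigr => i _; rewrite mxE.
Qed.

Lemma linear_factor (n : nat) (V W : normedModType R)
    (f : {linear 'rV[R]_n -> V}) (h : {linear 'rV[R]_n -> W}) :
  (forall x, exists a, f a = x) -> (forall a, f a = 0 -> h a = 0) ->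
  exists g : {linear V -> W}, continuous g /\ forall a, g (f a) = h a.
Proof.
move=> /choice[s fs] fh; pose g x := h (s x).
have gf a : g (f a) = h a.
  by apply/eqP; rewrite -subr_eq0 -linearB; apply/eqP/fh; rewrite linearB fs subrr.
have g_linear : linear g.
  by move=> c x y; rewrite -{1}(fs x) -{1}(fs y) -linearP gf linearP.
pose gL : {linear V -> W} :=
  HB.pack g (GRing.isLinear.Build _ _ _ _ _ g_linear).
exists gL; split=> //.
have [C C0 fC] := coordinates_bounded f.
have [B B0 hB] := linear_lipschitz (@rV_linear_continuous _ _ _ h).
apply: (@bounded_continuous _ _ _ _ (B * C)) => x /=.
have [b fb bC] := fC (s x).
have -> : g x = h b by rewrite -(gf b) fb fs.
apply: le_trans (hB b) _; rewrite -mulrA; apply: ler_wpM2l; first exact: ltW.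
by move: bC; rewrite fs.
Qed.

(** A vector of the unit ball is a point of the net plus a vector of norm at most
    1/2, so the norm of f is at most c plus half of itself. *)
Lemma op_norm_net (V W : normedModType R) (f : {linear V -> W}) (c : R) :
  continuous f ->
  (forall x, `|x| <= 1 -> exists2 m, `|f m| <= c & `|x - m| <= 2^-1) ->
  op_norm f <= c * 2.
Proof.
move=> fcont net; suff : op_norm f <= c + op_norm f * 2^-1 by lra.
apply: ge_sup => [|_ [x /= x1 <-]]; first by exists `|f 0|, 0 => //=; rewrite normr0.
have [m mc xm] := net x x1.
rewrite -[x](subrK m) linearD addrC (le_trans (ler_normD _ _))// lerD//.
by rewrite (le_trans (op_norm_ub _ fcont))// ler_wpM2l ?op_norm_ge0.
Qed.

End LinearMapsOnFiniteDimension.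

(** * From extension of functionals to local complementation *)

Section LocalComplementation.
Context (R : realType) (X : normedModType R) (Y : submodClosed X).

(** With M the range of T, and P a projection of the coordinates onto those of the
    vectors of Y, the map sought is T b |-> T (b P) + sum_l (b - b P)_l y_l: it
    is the identity on Y whatever the y_l are, and [helly] chooses them so that
    it is bounded on a net. *)
Theorem dual_extension_locally_complemented
    (G : {linear dual (submod Y) -> dual X}) :
  dual_extension G -> locally_complemented Y.
Proof.
move=> [/linear_lipschitz[k k0 Gk] Gext].
have k1 : k < k + 1 by rewrite ltrDl.
exists ((k + 1) * 2); first by rewrite mulr_gt0// addr_gt0.
move=> M /finite_dimensional_rV[n [T Tsurj]].
have [||P [PK KP]] := @subspace_projection R n [set a | val (T a) \in Y].
- by rewrite /= !linear0 rpred0.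
- by move=> c a b /= aY bY; rewrite !linearP rpredD ?rpredZ.
pose p a : submod Y := Submod (PK a).
have pE a : val (p a) = val (T (a *m P)) by [].
have [r [a [Ta1 Tnet]]] := @unit_ball_net _ _ _ T 2^-1 ltac:(by rewrite invr_gt0).
pose beta j l := (a j - a j *m P) 0 l.
have [psi psi_rel|y y_le] := @helly _ _ _ _ beta (fun j => p (a j)) k _ (ltW k0) k1.
  (* the linear relations, once G is applied, cancel the part of T (a j)
     that does not come from Y *)
  have -> : \sum_j dual_fun (psi j) (p (a j)) =
      \sum_j dual_fun (G (psi j)) (val (T (a j))).
    apply/esym/eqP; rewrite -subr_eq0 -sumrB.
    rewrite (eq_bigr (fun j =>
      \sum_l dual_fun (G (beta j l *: psi j)) (val (T 'e_l)))).
      rewrite exchange_big big1// => l _.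
      by rewrite -dual_fun_sum -linear_sum psi_rel linear0.
    move=> j _; rewrite -Gext pE -!linearB.
    rewrite {1}(row_sum_delta (a j - a j *m P)) !linear_sum.
    apply: eq_bigr => l _; rewrite [in RHS]linearZ dual_funZ [T (_ *: _)]linearZ.
    exact: (linearZ_LR (dual_fun (G (psi j)))).
  rewrite mulr_sumr; apply: ler_sum => j _; apply: le_trans (ler_norm _) _.
  apply: le_trans (op_norm_ub _ (@dual_continuous _ _ _)) _.
  apply: le_trans (ler_piMr _ _) (Gk _); rewrite ?op_norm_ge0//.
  by rewrite -normr_submod.
pose h b := p b + \sum_l (b - b *m P) 0 l *: y l.
have h_linear : linear h.
  move=> c b b'; rewrite /h.
  have -> : p (c *: b + b') = c *: p b + p b'.
    apply: val_inj; rewrite -[RHS]/(c *: val (p b) + val (p b')) !pE.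
    by rewrite mulmxDl -scalemxAl !linearP.
  rewrite scalerDr scaler_sumr addrACA -big_split; congr (_ + _).
  apply: eq_bigr => l _ /=; rewrite scalerA -scalerDl; congr (_ *: _).
  by rewrite mulmxDl -scalemxAl !mxE; ring.
pose hL : {linear 'rV[R]_n -> submod Y} :=
  HB.pack h (GRing.isLinear.Build _ _ _ _ _ h_linear).
have [b Tb0|f [fcont fT]] := @linear_factor _ _ _ _ T hL Tsurj.
  have bP : b *m P = b by apply: KP; rewrite /= Tb0; exact: rpred0.
  rewrite /= /h bP subrr big1 ?addr0; last by move=> l _; rewrite mxE scale0r.
  by apply: val_inj; rewrite pE bP Tb0.
exists f; split=> //.
  apply: op_norm_net => // x x1; have [b Tb] := Tsurj x.
  have [|j bj] := Tnet b; first by rewrite Tb.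
  by exists (T (a j)); [rewrite fT; exact: y_le | rewrite -Tb].
move=> x xY; have [b Tb] := Tsurj x; rewrite -Tb fT.
have bP : b *m P = b by apply: KP; rewrite /= Tb.
rewrite /= /h bP subrr big1; last by move=> l _; rewrite mxE scale0r.
by rewrite addr0.
Qed.

End LocalComplementation.

(** * Generalized limits *)

Section GeneralizedLimit.
Context (R : realType) (I : Type).

(** A linear functional on the families that are bounded along F, extending the
    limit along F; its values on the other families are arbitrary. *)
Record generalized_limit (F : set_system I) (ell : (I -> R) -> R) : Prop := {
  glim_linear : forall a u v C D,
    F [set i | `|u i| <= C] -> F [set i | `|v i| <= D] ->
    ell (fun i => a * u i + v i) = a * ell u + ell v;
  glim_bound : forall u C, F [set i | `|u i| <= C] -> `|ell u| <= C;
  glim_cst : forall c, ell (fun=> c) = c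
}.

Lemma fmap_ultra (T : Type) (F : set_system I) (f : I -> T) :
  UltraFilter F -> UltraFilter (f @ F).
Proof.
move=> FU; split=> [|G GP fFG]; first exact: fmap_proper_filter.
apply/seteqP; split=> // A GA.
have [//|FnA] := in_ultra_setVsetC (f @^-1` A) FU.
have /filter_ex[x [] //] : G (A `&` ~` A).
by apply: filterI => //; apply: fFG; rewrite /nbhs/=.
Qed.

Lemma bounded_ultra_cvg (F : set_system I) (u : I -> R) (C : R) :
  UltraFilter F -> F [set i | `|u i| <= C] -> cvg (u @ F).
Proof.
move=> FU uC; have fU := fmap_ultra u FU.
have := @segment_compact R (- C) C; rewrite compact_ultra.
move=> /(_ (u @ F) fU)[|x [_ ux]]; last by apply/cvg_ex; exists x.
  suff : F (u @^-1` `[- C, C]) by [].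
  by apply: filterS uC => i /=; rewrite in_itv/= ler_norml.
Qed.

Lemma generalized_limit_exists (F : set_system I) : ProperFilter F ->
  exists ell, generalized_limit F ell.
Proof.
move=> /ultraFilterLemma[U [UU FU]]; exists (fun u => lim (u @ U)); split.
- move=> a u v C D /FU uC /FU vD; apply/cvg_lim => //.
  apply: cvgD; last exact: (bounded_ultra_cvg UU vD).
  by apply: cvgMr; exact: (bounded_ultra_cvg UU uC).
- move=> u C /FU uC.
  have uc := bounded_ultra_cvg UU uC.
  rewrite ler_norml; apply/andP; split.
    by apply: limr_ge => //; apply: filterS uC => i /=; rewrite ler_norml => /andP[].
  by apply: limr_le => //; apply: filterS uC => i /=; rewrite ler_norml => /andP[].
- by move=> c; apply/cvg_lim => //; exact: cvg_cst.
Qed.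

Lemma glim_eq (F : set_system I) {FF : Filter F} ell u v C :
  generalized_limit F ell ->
  F [set i | `|v i| <= C] -> F [set i | u i = v i] -> ell u = ell v.
Proof.
move=> ellP vC uv.
have uC : F [set i | `|u i| <= C].
  by apply: filterS2 uv vC => i /= ->.
have uv0 : F [set i | `|-1 * v i + u i| <= 0].
  by apply: filterS uv => i /= ->; rewrite mulN1r addNr normr0.
have := glim_bound ellP uv0; rewrite (glim_linear ellP _ vC uC) normr_le0.
by rewrite mulN1r addrC subr_eq0 => /eqP.
Qed.

End GeneralizedLimit.

(** * From local complementation to extension of functionals *)

Section LocalComplementationConverse.
Context (R : realType) (X : normedModType R).

Section Span.
Context (s : seq X).

Definition span_pred : {pred X} :=
  fun x => `[< exists a : 'I_(size s) -> R, x = \sum_i a i *: s`_i >].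

Lemma span_submod_closed : submod_closed span_pred.
Proof.
split=> [|c x y /asboolP[a ->] /asboolP[b ->]].
  by apply/asboolP; exists (fun=> 0); rewrite big1// => i _; rewrite scale0r.
apply/asboolP; exists (fun i => c * a i + b i).
rewrite scaler_sumr -big_split; apply: eq_bigr => i _ /=.
by rewrite scalerDl scalerA.
Qed.

HB.instance Definition _ :=
  GRing.isSubmodClosed.Build R X span_pred span_submod_closed.

Lemma mem_span x : x \in s -> x \in span_pred.
Proof.
move=> xs; apply/asboolP.
have ks : (index x s < size s)%N by rewrite index_mem.
exists (fun i => (i == Ordinal ks)%:R).
rewrite (bigD1 (Ordinal ks))//= eqxx scale1r nth_index// big1 ?addr0// => i.
by move=> /negPf ->; rewrite scale0r.
Qed.

Lemma span_finite_dimensional : finite_dimensional (submod span_pred).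
Proof.
exists (size s).
have sP (i : 'I_(size s)) : s`_i \in span_pred by apply/mem_span/mem_nth.
exists (fun i => Submod (sP i)) => v.
have /asboolP[a va] := submod_valP v; exists a; apply: val_inj.
by rewrite [LHS]va raddf_sum.
Qed.
End Span.

(** Currying: a dual extension is a bounded bilinear form on Y^* x X that extends
    the duality between Y^* and Y. *)
Lemma dual_extension_of_form (Y : submodClosed X)
    (B : dual (submod Y) -> X -> R) (c : R) : 0 <= c ->
  (forall g a x y, B g (a *: x + y) = a * B g x + B g y) ->
  (forall x a f g, B (a *: f + g) x = a * B f x + B g x) ->
  (forall g x, `|B g x| <= c * `|g| * `|x|) ->
  (forall g y, B g (val y) = dual_fun g y) ->
  exists G : {linear dual (submod Y) -> dual X}, dual_extension G.
Proof.
move=> c0 Bx Bg Bc BY.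
have /choice[G GP] g : exists psi : dual X, dual_fun psi = B g /\ `|psi| <= c * `|g|.
  have cg : 0 <= c * `|g| by exact: mulr_ge0.
  have [psi psiE psi_le] :=
    bounded_linear_dual (Bx g : linear (B g : X -> R^o)) cg (Bc g).
  by exists psi.
have G_linear : linear G.
  move=> a f g; apply: val_inj; apply/funext => x.
  rewrite -[LHS]/(dual_fun (G (a *: f + g)) x).
  rewrite -[RHS]/(dual_fun (a *: G f + G g) x) dual_funD dual_funZ.
  by rewrite !(GP _).1 Bg.
pose GL : {linear dual (submod Y) -> dual X} :=
  HB.pack G (GRing.isLinear.Build _ _ _ _ _ G_linear).
exists GL; split=> [|g y]; last by rewrite /= (GP g).1 BY.
by apply: (@bounded_continuous _ _ _ GL c) => g; exact: (GP g).2.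
Qed.

(** The order filter of the finite subsets of T under inclusion; a finite subset
    is represented by any sequence that enumerates it. *)
Definition subset_filter (T : eqType) : set_system (seq T) :=
  [set A | exists s0 : seq T, forall s : seq T, {subset s0 <= s} -> A s].

Lemma subset_filter_proper (T : eqType) : ProperFilter (@subset_filter T).
Proof.
apply: Build_ProperFilter_ex => [A [s sA]|]; first by exists s; exact: sA.
split=> [|A B [s sA] [t tB]|A B AB [s sA]]; first by exists [::] => s _ /=.
  exists (s ++ t) => r st; split; [apply: sA|apply: tB] => x xs;
  by apply: st; rewrite mem_cat xs ?orbT.
by exists s => t /sA; exact: AB.
Qed.

(** The maps given by local complementation on the spans of the finite subsets
    need not be compatible with each other.  A generalized limit of their
    composites with g is nevertheless linear, since each linear relation
    between vectors holds on all spans that contain them. *)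
Theorem locally_complemented_dual_extension (Y : submodClosed X) :
  locally_complemented Y ->
  exists G : {linear dual (submod Y) -> dual X}, dual_extension G.
Proof.
move=> [c c0 lcY].
(* h s is the map on the span of s, extended by 0 off the span *)
have /choice[h hP] s : exists h : X -> submod Y,
    [/\ forall x, `|h x| <= c * `|x|,
        forall a x y, x \in span_pred s -> y \in span_pred s ->
          h (a *: x + y) = a *: h x + h y &
        forall y : submod Y, val y \in span_pred s -> h (val y) = y].
  have [f [fcont fc fid]] := lcY _ (span_finite_dimensional s).
  pose h x := if pselect (x \in span_pred s) is left xs then f (Submod xs) else 0.
  have hE m : h (val m) = f m.
    rewrite /h; case: pselect => [ms|]; last by case; exact: valP.
    by congr (f _); exact: val_inj.
  exists h; split=> [x|a x y xs ys|y ys].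
  - rewrite /h; case: pselect => [xs|_]; last by rewrite normr0 mulr_ge0// ltW.
    apply: le_trans (op_norm_ub _ fcont) _; exact: ler_wpM2r.
  - by rewrite (hE (a *: Submod xs + Submod ys)) linearP -!hE.
  - by apply: val_inj; rewrite (hE (Submod ys)) fid//; exact: (valP y).
have [ell ellP] := generalized_limit_exists R (subset_filter_proper X).
have Fspan x : subset_filter [set s | x \in span_pred s].
  by exists [:: x] => s xs; apply/mem_span/xs/mem_head.
have FP := subset_filter_proper X.
pose B (g : dual (submod Y)) x := ell (fun s => dual_fun g (h s x)).
have gh g x s : `|dual_fun g (h s x)| <= c * `|g| * `|x|.
  apply: le_trans (op_norm_ub _ (@dual_continuous _ _ _)) _.
  by rewrite -normr_dual -mulrA mulrCA ler_wpM2l//; have [] := hP s.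
have ghF g x : subset_filter [set s | `|dual_fun g (h s x)| <= c * `|g| * `|x|].
  by exists [::] => s _; exact: gh.
apply: (@dual_extension_of_form Y B c); first exact: ltW.
- move=> g a x y; rewrite /B -(glim_linear ellP _ (ghF g x) (ghF g y)).
  have gE : subset_filter [set s |
      dual_fun g (h s (a *: x + y)) = a * dual_fun g (h s x) + dual_fun g (h s y)].
    apply: filterS2 (Fspan x) (Fspan y) => s /= xs ys; have [_ hl _] := hP s.
    by rewrite hl// linearP.
  apply: (glim_eq ellP _ gE); apply: filterS (gE) => s /= <-; exact: gh.
- by move=> x a f g; exact: (glim_linear ellP _ (ghF f x) (ghF g x)).
- by move=> g x; exact: (glim_bound ellP (ghF g x)).
- move=> g y; rewrite -[RHS](glim_cst ellP).
  apply: (@glim_eq _ _ _ _ _ _ _ `|dual_fun g y| ellP).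
    by exists [::] => s _ /=.
  by apply: filterS (Fspan (val y)) => s /= ys; have [_ _ ->] := hP s.
Qed.
End LocalComplementationConverse.

(** * Invariant means on abelian groups *)

Section InvariantMean.
Context (R : realType) (V : zmodType).
Implicit Types (f g : V -> R) (v z : V) (s : seq V) (n : nat).

Definition avg n v f z : R := n.+1%:R^-1 * \sum_(k < n.+1) f (z + v *+ k).

Definition avgs n s f : V -> R := foldr (avg n) f s.

Lemma avg_bound n v f (C : R) : (forall z, `|f z| <= C) ->
  forall z, `|avg n v f z| <= C.
Proof.
move=> fC z; rewrite /avg normrM gtr0_norm ?invr_gt0// ler_pdivrMl//.
apply: le_trans (ler_norm_sum _ _ _) _.
apply: (@le_trans _ _ (\sum_(k < n.+1) C)); first exact: ler_sum.
by rewrite sumr_const card_ord mulr_natl.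
Qed.

Lemma avg_linear n v (a : R) f g z :
  avg n v (fun z => a * f z + g z) z = a * avg n v f z + avg n v g z.
Proof. by rewrite /avg big_split/= -mulr_sumr; ring. Qed.

Lemma avgs_bound n s f (C : R) : (forall z, `|f z| <= C) ->
  forall z, `|avgs n s f z| <= C.
Proof. by move=> fC; elim: s => //= v s; exact: avg_bound. Qed.

Lemma avgs_linear n s (a : R) f g z :
  avgs n s (fun z => a * f z + g z) z = a * avgs n s f z + avgs n s g z.
Proof.
elim: s z => //= v s IHs z; rewrite -avg_linear.
by congr (avg _ _ _ z); apply/funext => {}z; exact: IHs.
Qed.

Lemma avgs_shift n s f v z :
  avgs n s (fun z => f (z + v)) z = avgs n s f (z + v).
Proof.
elim: s z => //= w s IHs z; congr (_ * _); apply: eq_bigr => k _.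
by rewrite IHs addrAC.
Qed.

Lemma avgs_cst n s (c : R) z : avgs n s (fun=> c) z = c.
Proof.
elim: s z => //= w s IHs z.
rewrite /avg (eq_bigr (fun=> c)) => [|k _]; last exact: IHs.
by rewrite sumr_const card_ord -[c *+ _]mulr_natl mulKf.
Qed.

(** Averaging over 0, v, ..., n v telescopes on an increment in direction v; the
    other averages commute with translations and do not increase the sup norm. *)
Lemma avgs_almost_invariant n s f v (C : R) z :
  v \in s -> (forall z, `|f z| <= C) ->
  `|avgs n s f (z + v) - avgs n s f z| <= (C + C) / n.+1%:R.
Proof.
move=> vs fC; elim: s vs z => //= w s IHs; rewrite in_cons => /predU1P[<-|vs] z.
  pose u k := avgs n s f (z + v *+ k).
  have -> : avg n v (avgs n s f) (z + v) - avg n v (avgs n s f) z =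
      n.+1%:R^-1 * (u n.+1 - u 0%N).
    rewrite /avg -mulrBr -sumrB -(telescope_sumr u (leq0n n.+1)) big_mkord.
    by congr (_ * _); apply: eq_bigr => k _; rewrite /u mulrS addrA.
  rewrite normrM gtr0_norm ?invr_gt0// mulrC ler_pM2r ?invr_gt0//.
  by apply: le_trans (ler_normB _ _) _; apply: lerD; exact: avgs_bound.
rewrite /avg -mulrBr -sumrB normrM gtr0_norm ?invr_gt0// ler_pdivrMl//.
apply: le_trans (ler_norm_sum _ _ _) _.
apply: (@le_trans _ _ (\sum_(k < n.+1) (C + C) / n.+1%:R)).
  by apply: ler_sum => k _; rewrite addrAC; exact: IHs.
by rewrite sumr_const card_ord mulr_natl.
Qed.

(** The axioms concern bounded functions only; the values of a mean on the other
    functions are arbitrary. *)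
Record invariant_mean (m : (V -> R) -> R) : Prop := {
  mean_linear : forall a f g C D,
    (forall z, `|f z| <= C) -> (forall z, `|g z| <= D) ->
    m (fun z => a * f z + g z) = a * m f + m g;
  mean_bound : forall f C, (forall z, `|f z| <= C) -> `|m f| <= C;
  mean_cst : forall c, m (fun=> c) = c;
  mean_shift : forall f C v, (forall z, `|f z| <= C) ->
    m (fun z => f (z + v)) = m f
}.

(** Larger and larger lengths of averages, along more and more directions. *)
Definition folner_filter : set_system (nat * seq V) :=
  filter_from setT (fun i : nat * seq V =>
    [set j : nat * seq V | (i.1 <= j.1)%N /\ {subset i.2 <= j.2}]).

Lemma folner_filter_proper : ProperFilter folner_filter.
Proof.
apply: filter_from_proper; last first.
  by move=> [n s] _; exists (n, s); split=> /=.
apply: filter_from_filter; first by exists (0%N, [::]).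
move=> [n s] [m t] _ _; exists (maxn n m, s ++ t) => // -[k r] /= [nmk str].
split; split=> [|x xs]; rewrite ?(leq_trans (leq_maxl n m) nmk) //.
- by apply: str; rewrite mem_cat xs.
- exact: leq_trans (leq_maxr n m) nmk.
- by apply: str; rewrite mem_cat xs orbT.
Qed.

(** The averages [avgs] are asymptotically invariant, so a generalized limit of
    them is invariant. *)
Lemma invariant_mean_exists : exists m, invariant_mean m.
Proof.
have FP := folner_filter_proper.
have [ell ellP] := generalized_limit_exists R FP.
pose m f := ell (fun i => avgs i.1 i.2 f 0).
have bnd f C : (forall z, `|f z| <= C) ->
    folner_filter [set i | `|avgs i.1 i.2 f 0| <= C].
  by move=> fC; apply: filterE => i; exact: avgs_bound.
have m_linear a f g C D : (forall z, `|f z| <= C) -> (forall z, `|g z| <= D) ->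
    m (fun z => a * f z + g z) = a * m f + m g.
  move=> fC gD; rewrite -(glim_linear ellP _ (bnd _ _ fC) (bnd _ _ gD)).
  by congr ell; apply/funext => i; exact: avgs_linear.
exists m; split=> //.
- by move=> f C /bnd; exact: glim_bound.
- move=> c; rewrite -[RHS](glim_cst ellP).
  by congr ell; apply/funext => i; exact: avgs_cst.
move=> f C v fC; apply/eqP; rewrite -subr_eq0 -normr_le0.
apply/ler_addgt0Pr => e e0; rewrite add0r.
have -> : m (fun z => f (z + v)) - m f = m (fun z => -1 * f z + f (z + v)).
  by rewrite (m_linear _ _ _ C C)// mulN1r addrC.
apply: (glim_bound ellP).
have C0 : 0 <= C by exact: le_trans (normr_ge0 _) (fC 0).
(* averages of length greater than 2C/e that include the direction v *)
exists (Num.truncn ((C + C) / e), [:: v]) => // -[n s] /= [ns vs].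
rewrite avgs_linear avgs_shift mulN1r addrC.
apply: le_trans (avgs_almost_invariant _ _ _ fC) _.
  by apply: vs; rewrite mem_head.
rewrite ler_pdivrMr// mulrC -ler_pdivrMr//.
apply/ltW; apply: lt_le_trans (truncnS_gt _) _.
by rewrite ler_nat ltnS.
Qed.

End InvariantMean.

(** * From extension of Lipschitz functions to extension of functionals *)

Section AdditiveBounded.
Context (R : realType) (V : normedModType R).

(** For each n, the real n a is within 1 of an integer, for which homogeneity
    follows from additivity; so n (S (a x) - a S x) is bounded independently
    of n. *)
Lemma additive_bounded_homogeneous (S : V -> R) (K : R) :
  (forall x y, S (x + y) = S x + S y) -> (forall x, `|S x| <= K * `|x|) ->
  forall a x, S (a *: x) = a * S x.
Proof.
move=> SD SK a x.
have S0 : S 0 = 0 by have := SD 0 0; rewrite addr0; lra.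
have Sn n y : S (y *+ n) = S y *+ n.
  by elim: n => [|n IHn]; rewrite ?mulr0n// !mulrS SD IHn.
have SN y : S (- y) = - S y.
  by have := SD y (- y); rewrite subrr S0; lra.
have Sz (k : int) y : S (k%:~R *: y) = k%:~R * S y.
  case: k => n; first by rewrite -pmulrn scaler_nat Sn mulr_natl.
  by rewrite NegzE mulrNz -pmulrn scaleNr SN scaler_nat Sn mulNr mulr_natl.
pose C := K * `|x| + `|S x|.
apply/eqP; rewrite -subr_eq0 -normr_le0; apply/ler_addgt0Pr => e e0; rewrite add0r.
have C0 : 0 <= C by rewrite addr_ge0// (le_trans _ (SK x)).
pose n := (Num.truncn (C / e)).+1.
have nC : C / e <= n%:R by apply/ltW; exact: truncnS_gt.
pose k := Num.floor (n%:R * a); pose d := n%:R * a - k%:~R.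
have d1 : `|d| <= 1.
  have /andP[k1 k2] := floor_itv (n%:R * a : R).
  by rewrite /d ger0_norm; [move: k2; rewrite intrD; lra | rewrite subr_ge0].
have nE : n%:R * (S (a *: x) - a * S x) = S (d *: x) - d * S x.
  have nS : n%:R * S (a *: x) = k%:~R * S x + S (d *: x).
    rewrite -Sz -SD -scalerDl /d addrC subrK.
    by rewrite mulr_natl -Sn -scaler_nat scalerA.
  by rewrite mulrBr nS /d; ring.
rewrite -(@ler_pM2l _ n%:R) ?ltr0n// -{1}(gtr0_norm (_ : 0 < n%:R)) ?ltr0n//.
rewrite -normrM nE; apply: (@le_trans _ _ C).
  rewrite /C; apply: le_trans (ler_normB _ _) _; apply: lerD.
    apply: le_trans (SK _) _; rewrite normrZ mulrCA ler_piMl//.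
    exact: le_trans (SK x).
  by rewrite normrM ler_piMl.
by rewrite -ler_pdivrMr.
Qed.

End AdditiveBounded.

Section LipschitzExtension.
Context (R : realType) (X : normedModType R) (Y : submodClosed X).

Section Averaging.
Variables (mX : (X -> R) -> R) (mY : (submod Y -> R) -> R).
Hypotheses (mXP : invariant_mean mX) (mYP : invariant_mean mY).
Implicit Types (F : X -> R) (K : R).

(** The increment at z of the function obtained by averaging F over translations
    by Y.  That function itself would be the mean of an unbounded function, so
    only its increments are defined. *)
Definition mean_diff F x z : R := mY (fun y => F (x + z + val y) - F (z + val y)).
Definition linearization F x : R := mX (mean_diff F x).

Let lip F K := forall x y, `|F x - F y| <= K * `|x - y|.

Let diff_bound F K x z : lip F K ->
  forall y : submod Y, `|F (x + z + val y) - F (z + val y)| <= K * `|x|.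
Proof.
move=> FK y; apply: le_trans (FK _ _) _.
by rewrite -[x + z + _]addrA addrK.
Qed.

Let mean_diff_bound F K x : lip F K -> forall z, `|mean_diff F x z| <= K * `|x|.
Proof. by move=> FK z; apply: (mean_bound mYP); exact: diff_bound. Qed.

Lemma linearization_bound F K x : lip F K -> `|linearization F x| <= K * `|x|.
Proof. by move=> FK; apply: (mean_bound mXP); exact: mean_diff_bound. Qed.

(** The increment x + x' from z is x from z + x' followed by x' from z, and the
    mean over z does not see the translation by x'. *)
Lemma linearizationD F K x x' : lip F K ->
  linearization F (x + x') = linearization F x + linearization F x'.
Proof.
move=> FK.
have -> : linearization F (x + x') =
    mX (fun z => 1 * mean_diff F x (z + x') + mean_diff F x' z).
  congr mX; apply/funext => z; rewrite /mean_diff.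
  have DF := mean_linear mYP 1 (diff_bound x (z + x') FK) (diff_bound x' z FK).
  rewrite -DF; congr mY; apply/funext => y.
  by rewrite mul1r [z + x']addrC subrKA addrA.
rewrite (mean_linear mXP _ (C := K * `|x|) (D := K * `|x'|)) => [|z|z].
- by rewrite mul1r (mean_shift mXP _ (C := K * `|x|))// => z; exact: mean_diff_bound.
- exact: mean_diff_bound.
- exact: mean_diff_bound.
Qed.

Lemma linearization_linear F G a K K' x : lip F K -> lip G K' ->
  linearization (fun z => a * F z + G z) x =
    a * linearization F x + linearization G x.
Proof.
move=> FK GK.
rewrite -(mean_linear mXP _ (mean_diff_bound x FK) (mean_diff_bound x GK)).
congr mX; apply/funext => z.
rewrite -(mean_linear mYP _ (diff_bound x z FK) (diff_bound x z GK)).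
by congr mY; apply/funext => y; ring.
Qed.

(** The increment along y0 of F (z + y) differs from that of F (y), which is the
    constant g y0, by an increment along y0 of the bounded function
    F (z + y) - F (y) of y; the mean over Y annihilates the latter. *)
Lemma linearization_extends F K (g : submod Y -> R) (y0 : submod Y) : lip F K ->
  (forall y y', g (y + y') = g y + g y') -> (forall y, F (val y) = g y) ->
  linearization F (val y0) = g y0.
Proof.
move=> FK gD Fg; rewrite -[RHS](mean_cst mXP); congr mX; apply/funext => z.
pose u (y : submod Y) := F (z + val y) - F (val y).
have u_le y : `|u y| <= K * `|z| by apply: le_trans (FK _ _) _; rewrite addrK.
have u_shift_le y : `|u (y + y0)| <= K * `|z| by [].
have g_le (y : submod Y) : `|g y0| <= `|g y0| by [].
have -> : mean_diff F (val y0) z = mY (fun y => -1 * u y + (1 * u (y + y0) + g y0)).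
  congr mY; apply/funext => y; rewrite /u !Fg gD.
  rewrite (_ : val y0 + z + val y = z + val (y + y0)); first by ring.
  by rewrite raddfD addrA [RHS]addrC addrA.
rewrite (mean_linear mYP _ (C := K * `|z|) (D := K * `|z| + `|g y0|))// => [|y].
  rewrite (mean_linear mYP _ u_shift_le g_le) (mean_shift mYP _ u_le) (mean_cst mYP).
  by ring.
by rewrite mul1r; apply: le_trans (ler_normD _ _) _; rewrite lerD2r.
Qed.

End Averaging.

Lemma lip0_of_dual_subproof (V : normedModType R) (g : dual V) :
  dual_fun g \in @lip0_pred R V.
Proof.
apply/asboolP; split; last exact: linear0.
apply/lipschitzP; exists `|g| => x y; rewrite -linearB.
exact: op_norm_ub (@dual_continuous _ _ g).
Qed.

Definition lip0_of_dual (V : normedModType R) (g : dual V) : Lip0 V :=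
  Submod (lip0_of_dual_subproof g).

Lemma lip0_of_dual_norm (V : normedModType R) (g : dual V) :
  `|lip0_of_dual g| <= `|g|.
Proof.
rewrite normr_Lip0; apply: lip_norm_le => // x y; rewrite /lip0_fun /= -linearB.
exact: op_norm_ub (@dual_continuous _ _ g).
Qed.

(** The composite of the inclusion of Y^* in Lip_0(Y), of L, and of the
    linearization. *)
Theorem lip_extension_dual_extension (L : {linear Lip0 (submod Y) -> Lip0 X}) :
  lip_extension L ->
  exists G : {linear dual (submod Y) -> dual X}, dual_extension G.
Proof.
move=> [/linear_lipschitz[k k0 Lk] Lext].
have [mX mXP] := invariant_mean_exists R X.
have [mY mYP] := invariant_mean_exists R (submod Y).
pose F g := lip0_fun (L (lip0_of_dual g)).
have Flip g x y : `|F g x - F g y| <= k * `|g| * `|x - y|.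
  apply: le_trans (lip_norm_ub _ _ (@lip0_lipschitz _ _ _)) _.
  apply: ler_wpM2r => //; apply: le_trans (Lk _) _.
  by rewrite ler_pM2l// lip0_of_dual_norm.
have Flinear a f g : F (a *: f + g) = fun x => a * F f x + F g x.
  apply/funext => x; rewrite /F -lip0_funZ -lip0_funD -linearP.
  by congr (lip0_fun (L _) x); exact: val_inj.
apply: (@dual_extension_of_form _ _ _ (fun g => linearization mX mY (F g)) k).
- exact: ltW.
- move=> g a x y; rewrite (linearizationD mXP mYP _ _ (Flip g)); congr (_ + _).
  apply: (@additive_bounded_homogeneous _ _ _ (k * `|g|)) => [u v|u].
    exact: linearizationD (Flip g).
  exact: linearization_bound.
- by move=> x a f g; rewrite Flinear; exact: linearization_linear (Flip f) (Flip g).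
- by move=> g x; exact: linearization_bound.
move=> g y; apply: (linearization_extends mXP mYP y (Flip g)) => [u v|u].
  exact: linearD.
by rewrite /F Lext.
Qed.

End LipschitzExtension.

(** * Lipschitz retracts *)

Theorem lipschitz_retract_lip_extension (R : realType) (X : normedModType R)
    (Y : submodClosed X) :
  lipschitz_retract [set x : X | x \in (Y : {pred X})] ->
  exists L : {linear Lip0 (submod Y) -> Lip0 X}, lip_extension L.
Proof.
move=> [r [rY rlip rid]].
have [k k0 rk] : exists2 k, 0 < k & forall x y, `|r x - r y| <= k * `|x - y|.
  have /pinfty_ex_gt0[k k0 rk] := rlip.
  by exists k => // x y; exact: (rk (x, y)).
pose rho x : submod Y := Submod (rY x).
have rho_lip x y : `|rho x - rho y| <= k * `|x - y| by exact: rk.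
have rho_val y : rho (val y) = y by apply: val_inj; exact: rid (valP y).
have comp_lip (g : Lip0 (submod Y)) x y :
    `|lip0_fun g (rho x) - lip0_fun g (rho y)| <= k * `|g| * `|x - y|.
  apply: le_trans (lip_norm_ub _ _ (@lip0_lipschitz _ _ g)) _.
  by rewrite -normr_Lip0 -mulrA mulrCA ler_wpM2l.
have LP (g : Lip0 (submod Y)) : (fun x => lip0_fun g (rho x)) \in @lip0_pred R X.
  apply/asboolP; split.
    by apply/lipschitzP; exists (k * `|g|); exact: comp_lip.
  by rewrite (rho_val 0) lip0_at0.
pose L g : Lip0 X := Submod (LP g).
have L_linear : linear L by move=> a f g; exact: val_inj.
pose LL : {linear Lip0 (submod Y) -> Lip0 X} :=
  HB.pack L (GRing.isLinear.Build _ _ _ _ _ L_linear).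
exists LL; split=> [|g y]; last by rewrite /lip0_fun/= rho_val.
apply: (@bounded_continuous _ _ _ LL k) => g.
rewrite normr_Lip0; apply: lip_norm_le; last exact: comp_lip.
by rewrite mulr_ge0// ltW.
Qed.

Theorem theorem3p17 (R : realType) (X : completeNormedModType R)
    (Y : submodClosed X) :
  [/\ (exists L : {linear Lip0 (submod Y) -> Lip0 X}, lip_extension L) ->
        (exists G : {linear dual (submod Y) -> dual X}, dual_extension G) /\
        locally_complemented Y,
      (exists G : {linear dual (submod Y) -> dual X}, dual_extension G) <->
        locally_complemented Y &
      lipschitz_retract [set x : X | x \in (Y : {pred X})] ->
        locally_complemented Y].
Proof.
have dual_lc : (exists G : {linear dual (submod Y) -> dual X}, dual_extension G) ->
    locally_complemented Y.
  by move=> [G]; exact: dual_extension_locally_complemented.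
have lip_dual : (exists L : {linear Lip0 (submod Y) -> Lip0 X}, lip_extension L) ->
    exists G : {linear dual (submod Y) -> dual X}, dual_extension G.
  by move=> [L]; exact: lip_extension_dual_extension.
split.
- by move=> /lip_dual ?; split=> //; exact: dual_lc.
- by split=> //; exact: locally_complemented_dual_extension.
- by move=> /lipschitz_retract_lip_extension /lip_dual /dual_lc.
Qed.
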